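(* Let $g$ and $d$ be positive integers with $d\mid g$, and let $P_\ast^{(g,d)}=B_{\tilde I_{2d}}\big(J_{g/d}([(g/d)^2])\big)$. Then there exists a set $\mathcal{P}$ of $d$ $(2g,2g,1,g(2g-1))$ PDAs that are Blackburn-compatible w.r.t. $P_\ast^{(g,d)}$ and such that $L_{\mathcal{P},P_\ast^{(g,d)}}(I_d)$ is a $2d$-regular $(2gd,\;2gd,\;2gd-3g+g/d+1,\;g(3g-g/d-1))$ PDA.
   Context: Notation: $[n]=\{0,1,\dots,n-1\}$. For positive integers $K,f$, a nonnegative integer $Z$ and a finite set $\mathcal{S}$ of integers, a $(K,f,Z,\mathcal{S})$ placement delivery array (PDA) is an $f\times K$ array $P=[p_{j,k}]$ with entries in $\mathcal{S}\cup\{\ast\}$ such that: (C1) $\ast$ appears exactly $Z$ times in each column; (C2) each $s\in\mathcal{S}$ occurs at least once; (C3, Blackburn property) if two distinct cells $(j_1,k_1)$, $(j_2,k_2)$ contain the same integer then $p_{j_1,k_2}=p_{j_2,k_1}=\ast$. It is $g$-regular if each integer of $\mathcal{S}$ occurs exactly $g$ times. A number $S$ in place of the set means the integer set has $S$ elements. Blackburn compatibility: for arrays $P_0,P_1,P_\ast$ of the same size, $P_0$ and $P_1$ are Blackburn-compatible w.r.t. $P_\ast$ if, whenever $p^{(0)}_{i_1j_1}=p^{(1)}_{i_2j_2}\neq\ast$, we have $p^{(\ast)}_{i_1j_2}=p^{(\ast)}_{i_2j_1}=\ast$. A family is Blackburn-compatible w.r.t. $P_\ast$ if any two different members of the family are.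 $\tilde I_n(t)$ is the $n\times n$ array with integer $t$ on the anti-diagonal and $\ast$ elsewhere. The array $P_\ast^{(g,d)}=B_{\tilde I_{2d}}(J_{g/d}([(g/d)^2]))$ is the $2g\times 2g$ array which is a $(g/d)\times(g/d)$ block array with blocks $\tilde I_{2d}(t)$ for $(g/d)^2$ distinct integers $t$, one per block. Lifting of $I_d$: for $\mathcal{P}=\{P_0,\dots,P_{d-1}\}$ and $P_\ast$ of the same size, $L_{\mathcal{P},P_\ast}(I_d)$ is the $d\times d$ block array whose $i$-th diagonal block is $P_i$ and whose off-diagonal blocks are copies of $P_\ast$ with integers relabelled so that the integer sets of these copies are disjoint from each other and from the integers of $P_0,\dots,P_{d-1}$. *)

(* Defs.v *)
From mathcomp Require Import all_boot all_order all_algebra finmap.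

Set Implicit Arguments.
Unset Strict Implicit.
Unset Printing Implicit Defensive.

Import Order.TTheory GRing.Theory Num.Theory.

(* Cells hold [Some s] for the integer [s] and [None] for the symbol [*]. *)
Notation array m n := 'M[option int]_(m, n).

Definition occurs m n (s : int) (P : array m n) : Prop :=
  exists i j, P i j = Some s.

(* A PDA on K columns and f rows. *)
Definition pda (K f Z : nat) (S : {fset int}) (P : array f K) : Prop :=
  [/\ (0 < K) /\ (0 < f),
      forall j k s, P j k = Some s -> s \in S,
      forall k, #|[set j | P j k == None]| = Z,
      forall s, s \in S -> occurs s P &
      forall j1 k1 j2 k2 s, (j1, k1) != (j2, k2) ->
        P j1 k1 = Some s -> P j2 k2 = Some s ->
        P j1 k2 = None /\ P j2 k1 = None].

Definition pda_card (K f Z S : nat) (P : array f K) : Prop :=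
  exists2 A : {fset int}, #|` A| = S & pda Z A P.

Definition regular_pda_card (g K f Z S : nat) (P : array f K) : Prop :=
  exists A : {fset int},
    [/\ #|` A| = S, pda Z A P &
        forall s, s \in A -> #|[set c | P c.1 c.2 == Some s]| = g].

Definition compatible m n (Q P0 P1 : array m n) : Prop :=
  forall i1 j1 i2 j2, P0 i1 j1 = P1 i2 j2 -> P0 i1 j1 <> None ->
    Q i1 j2 = None /\ Q i2 j1 = None.

Definition compatible_family m n (I : eqType) (Q : array m n)
    (P : I -> array m n) : Prop :=
  forall i j, i != j -> compatible Q (P i) (P j).

Lemma sum_ord_const a m : \sum_(i < a) m = m * a.
Proof. by rewrite big_const_ord iter_addn_0. Qed.

Definition block_array a m n (B : 'I_a -> 'I_a -> array m n) :
    array (m * a) (n * a) :=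
  castmx (sum_ord_const a m, sum_ord_const a n) (\mxblock_(i, j) B i j).

Definition antidiag (n : nat) (t : int) : array n n :=
  \matrix_(i, j) if j == rev_ord i then Some t else None.

(* The n x n array listing 0, 1, ..., n^2 - 1 row by row. *)
Definition all_distinct (n : nat) : 'M[int]_n :=
  \matrix_(i, j) Posz (i * n + j).

Lemma P_star_size g d : d %| g -> 2 * d * (g %/ d) = 2 * g.
Proof. by move=> dvd_dg; rewrite -mulnA (mulnC d) divnK. Qed.

Definition P_star (g d : nat) (dvd_dg : d %| g) : array (2 * g) (2 * g) :=
  castmx (P_star_size dvd_dg, P_star_size dvd_dg)
    (block_array (fun i j : 'I_(g %/ d) =>
       antidiag (2 * d) (all_distinct (g %/ d) i j))).

(* [rho i j] relabels the copy of Q in the off-diagonal block (i, j). *)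
Definition fresh_relabelling d m n (P : 'I_d -> array m n) (Q : array m n)
    (rho : 'I_d -> 'I_d -> int -> int) : Prop :=
  (forall i j i' j' s t, i != j -> i' != j' -> occurs s Q -> occurs t Q ->
     rho i j s = rho i' j' t -> [/\ i = i', j = j' & s = t]) /\
  (forall i j k s, i != j -> occurs s Q -> ~ occurs (rho i j s) (P k)).

(* L is the lifting of I_d by P and Q.  It is only determined up to the choice
   of the fresh integers, hence a relation. *)
Definition is_lifting d m n (P : 'I_d -> array m n) (Q : array m n)
    (L : array (m * d) (n * d)) : Prop :=
  exists2 rho, fresh_relabelling P Q rho &
    L = block_array (fun i j =>
          if i == j then P i else map_mx (omap (rho i j)) Q).

Lemma lifting_exists d m n (P : 'I_d -> array m n) (Q : array m n) :
  exists L, is_lifting P Q L.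
Proof.
pose v (k : 'I_d) i j : nat := if P k i j is Some z then `|z|%N else 0.
pose N : nat := \max_k \max_i \max_j v k i j.
pose rho (i j : 'I_d) (s : int) : int := Posz (N + choice.pickle (i, j, s)).+1.
exists (block_array (fun i j =>
          if i == j then P i else map_mx (omap (rho i j)) Q)).
exists rho => //; split=> [i j i' j' s t _ _ _ _ [/addnI]|].
  by move/(pcan_inj choice.pickleK) => [-> -> ->].
move=> i j k s _ _ [a [b Pk]].
have: v k a b <= N.
  apply: leq_trans (leq_bigmax k); apply: leq_trans (leq_bigmax a).
  exact: (leq_bigmax b).
by rewrite /v Pk /= ltnNge leq_addr.
Qed.

(* Main.v *)
(** In a 2g x 2g PDA with one star per column every integer occurs at most twice, and a
pair of cells with the same integer determines an edge of the complete graph on the 2g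
rows; so we look for arrays [P_a] whose integers are the edges of K_2g, namely
[P_a i j] = the label of [pi_a {i, c j}], where [c] is a fixed bijection from columns to rows
and [pi_a] is a permutation of the edges.  Put rows and columns into 2d classes (their
positions inside the blocks of [P_star]), and let [c] reverse the position inside each block.
Then [P_star] has a star at (i, j) exactly when i and [c j] lie in different classes, so
compatibility means: edges e, e' with [pi_a e = pi_b e'], a <> b, involve disjoint sets
of classes.  Such [pi_a] are lifted from K_2d with loops: decompose K_2d into 2d - 1 perfect
matchings by the circle method, and let [pi_a] shift the d edges of each matching, and
the 2d loops, cyclically by a. *)
Require Import Defs.
From mathcomp Require Import all_boot all_order all_algebra finmap.
From mathcomp Require Import zify.

Set Implicit Arguments.
Unset Strict Implicit.
Unset Printing Implicit Defensive.

(** * Block coordinates, and counting integers and stars blockwise *)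

Definition block_index a m (x : 'I_a * 'I_m) : 'I_(m * a) :=
  cast_ord (sum_ord_const a m) (@tagnat.Rank a (fun=> m) x.1 x.2).

Definition block_coord a m (s : 'I_(m * a)) : 'I_a * 'I_m :=
  let s' : 'I_(\sum_(i < a) m) := cast_ord (esym (sum_ord_const a m)) s in
  (tagnat.sig1 s', tagnat.sig2 s').

Lemma block_coordK a m : cancel (@block_coord a m) (@block_index a m).
Proof.
by move=> s; rewrite /block_index /block_coord /= tagnat.sig2K cast_ordKV.
Qed.

Lemma block_indexK a m : cancel (@block_index a m) (@block_coord a m).
Proof.
move=> [i j]; rewrite /block_index /block_coord /= cast_ordK.
by congr pair; rewrite ?tagnat.Rank1K // tagnat.Rank2K; apply: val_inj.
Qed.

Lemma block_index_bij a m : bijective (@block_index a m).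
Proof. by exists (@block_coord a m); [apply: block_indexK|apply: block_coordK]. Qed.

Lemma block_arrayE a m n (B : 'I_a -> 'I_a -> array m n) x y :
  block_array B (block_index x) (block_index y) = B x.1 y.1 x.2 y.2.
Proof.
rewrite /block_array castmxE mxE -{3 4}(block_indexK x) -{3 4}(block_indexK y).
by rewrite /block_coord.
Qed.

Definition cell_count m n (s : int) (P : array m n) : nat :=
  #|[set c | P c.1 c.2 == Some s]|.

Definition star_count m n (P : array m n) (k : 'I_n) : nat :=
  #|[set j | P j k == None]|.

Lemma cell_count_sum m n s (P : array m n) :
  cell_count s P = \sum_i \sum_j (P i j == Some s).
Proof.
rewrite /cell_count -sum1dep_card pair_big /= big_mkcond /=.
by apply: eq_bigr => c _; case: (_ == _).
Qed.

Lemma star_count_sum m n (P : array m n) k :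
  star_count P k = \sum_i (P i k == None).
Proof.
rewrite /star_count -sum1dep_card big_mkcond /=.
by apply: eq_bigr => c _; case: (_ == _).
Qed.

Lemma cell_count_gt0 m n s (P : array m n) : 0 < cell_count s P -> occurs s P.
Proof. by case/card_gt0P => -[i j]; rewrite inE => /eqP; exists i, j. Qed.

Lemma cell_count_eq0 m n s (P : array m n) : ~ occurs s P -> cell_count s P = 0.
Proof.
by move=> Ps; apply/eqP; rewrite -leqn0 leqNgt; apply/negP => /cell_count_gt0.
Qed.

Lemma card_offdiag (T : finType) : #|[pred x : T * T | x.1 != x.2]| = #|T| * #|T|.-1.
Proof.
rewrite -sum1_card big_mkcond /=.
rewrite -(pair_bigA _ (fun i j => if i != j then 1 else 0)) /= -sum_nat_const.
apply: eq_bigr => i _; rewrite -big_mkcond sum1_card.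
by rewrite -(cardC1 i); apply: eq_card => j; rewrite !inE unfold_in eq_sym.
Qed.

Lemma cell_count_block a m n s (B : 'I_a -> 'I_a -> array m n) :
  cell_count s (block_array B) = \sum_i \sum_j cell_count s (B i j).
Proof.
rewrite cell_count_sum (reindex (@block_index a m)) /=; last first.
  exact/onW_bij/block_index_bij.
transitivity (\sum_(x : 'I_a * 'I_m) \sum_(y : 'I_a * 'I_n)
                 (B x.1 y.1 x.2 y.2 == Some s)).
  apply: eq_bigr => x _; rewrite (reindex (@block_index a n)) /=; last first.
    exact/onW_bij/block_index_bij.
  by apply: eq_bigr => y _; rewrite block_arrayE.
rewrite -(pair_bigA _ (fun i k => \sum_(y : 'I_a * 'I_n)
                 (B i y.1 k y.2 == Some s))) /=.
apply: eq_bigr => i _.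
under eq_bigr => k _ do
  rewrite -(pair_bigA _ (fun j l => nat_of_bool (B i j k l == Some s))) /=.
by rewrite exchange_big /=; apply: eq_bigr => j _; rewrite cell_count_sum.
Qed.

Lemma star_count_block a m n (B : 'I_a -> 'I_a -> array m n) y :
  star_count (block_array B) (block_index y) =
    \sum_i star_count (B i y.1) y.2.
Proof.
rewrite star_count_sum (reindex (@block_index a m)) /=; last first.
  exact/onW_bij/block_index_bij.
under eq_bigr => x _ do rewrite block_arrayE.
rewrite -(pair_bigA _ (fun i k => nat_of_bool (B i y.1 k y.2 == None))) /=.
by apply: eq_bigr => i _; rewrite star_count_sum.
Qed.

(** The integer set stays explicit because the diagonal blocks of the lifting must all use the same
    one. *)
Definition regular_pda (r f K Z : nat) (S : {fset int}) (P : array f K) : Prop :=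
  pda Z S P /\ forall s, s \in S -> cell_count s P = r.

(** * Liftings of the identity *)

Section Lifting.

Variables (d m n r Z Z' : nat) (A B : {fset int}).
Variables (P : 'I_d -> array m n) (Q : array m n).

Hypothesis d_gt0 : 0 < d.
Hypothesis r_gt0 : 0 < r.
Hypothesis P_reg : forall i, regular_pda r Z A (P i).
Hypothesis Q_reg : regular_pda (d * r) Z' B Q.
Hypothesis PQ : compatible_family Q P.

(** An integer of [A] occurs [r] times in each of the [d] diagonal blocks, a fresh one only in its
    own copy of [Q]; regularity [d * r] of [Q] balances the two. For equal integers in two different
    diagonal blocks, the crossing cells lie in copies of [Q], and compatibility makes them stars. *)
Lemma lifting_regular L : is_lifting P Q L ->
  regular_pda_card (d * r) (Z + d.-1 * Z') (#|` A| + d * d.-1 * #|` B|) L.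
Proof.
case=> rho [rho_inj rho_fresh] ->.
have [[[n0 m0] QB Qst Qocc QC3] Qct] := Q_reg.
have PA k i j s : P k i j = Some s -> s \in A.
  by have [[_ H _ _ _] _] := P_reg k; apply: H.
have Pst k l : star_count (P k) l = Z by have [[_ _ H _ _] _] := P_reg k; apply: H.
have Pct k s : s \in A -> cell_count s (P k) = r.
  by have [_] := P_reg k; apply.
have Pocc k s : s \in A -> occurs s (P k).
  by move=> sA; apply: cell_count_gt0; rewrite Pct.
(* [T] indexes the off-diagonal blocks, so the fresh integers form the image [F] of [T * B] under an
   injection, which gives their number. *)
pose T : finType := {x : 'I_d * 'I_d | x.1 != x.2}.
pose lab (x : T * B) := rho (val x.1).1 (val x.1).2 (val x.2).
have lab_inj : injective lab.
  move=> [[[i j] /= ij] s] [[[i' j'] /= ij'] t] /rho_inj [] //=.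
  - exact/Qocc/valP.
  - exact/Qocc/valP.
  by move=> e1 e2 /val_inj ->; congr (_, _); apply: val_inj; rewrite /= e1 e2.
pose F := [fset lab x | x in {: T * B}]%fset.
have FP i j s : i != j -> s \in B -> rho i j s \in F.
  move=> ij sB; apply/imfsetP; exists (exist _ (i, j) ij, [` sB]%fset) => //.
(* Freshness only excludes integers occurring in some [P k]; as [r] is positive, each integer of [A]
   occurs already in block 0. *)
have FA : [disjoint A & F]%fset.
  apply/fdisjointP => s sA; apply/negP => /imfsetP /= [[[[i j] /= ij] t] _ e].
  move: sA; rewrite e => /(Pocc (Ordinal d_gt0)).
  by apply: rho_fresh => //; apply/Qocc/valP.

have cardF : #|` F| = d * d.-1 * #|` B|.
  rewrite card_imfset //= -cardE card_prod card_sig card_offdiag card_ord.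
  by rewrite cardfE.
have ct s : s \in (A `|` F)%fset -> cell_count s (block_array (fun i j =>
    if i == j then P i else map_mx (omap (rho i j)) Q)) = d * r.
  rewrite cell_count_block inE => /orP[sA|].
    rewrite -[d in RHS]card_ord -sum_nat_const; apply: eq_bigr => i _.
    rewrite (bigD1 i) //= eqxx Pct // big1 ?addn0 // => j ji.
    rewrite eq_sym (negPf ji) cell_count_eq0 // => -[k [l]].
    rewrite mxE; case Qkl : (Q k l) => [t|] //= [e].
    have /fdisjointP /(_ _ sA) /negP := FA; apply.
    by rewrite -e; apply: FP; [rewrite eq_sym|apply: QB Qkl].
  case/imfsetP => -[[[i0 j0] /= ij] t] _ ->.
  have tQ : occurs (val t) Q by exact/Qocc/valP.
  rewrite (bigD1 i0) //= (bigD1 j0) //= (negPf ij).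
  (* Relabelling is injective on the integers of [Q], so it preserves multiplicities. *)
  rewrite {1}/cell_count (eq_card (B := [set c | Q c.1 c.2 == Some (val t)])); last first.
    move=> [k l]; rewrite !inE /= mxE; case Qkl : (Q k l) => [u|] //=.
    apply/eqP/eqP => [[e]|[->]] //; rewrite /lab /= in e.
    have uQ : occurs u Q by exists k, l.
    by have [_ _ ->] := rho_inj _ _ _ _ _ _ ij ij uQ tQ e.
  have H i j : (i, j) != (i0, j0) -> cell_count (rho i0 j0 (val t))
      (if i == j then P i else map_mx (omap (rho i j)) Q) = 0.
    move=> ne; case: eqP => [_|/eqP ij']; apply: cell_count_eq0.
      exact: rho_fresh.
    case=> k [l]; rewrite mxE; case Qkl : (Q k l) => [u|] //= [e].
    have uQ : occurs u Q by exists k, l.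
    have [e1 e2 _] := rho_inj _ _ _ _ _ _ ij' ij uQ tQ e.
    by rewrite e1 e2 eqxx in ne.
  rewrite -/(cell_count (val t) Q) Qct ?fsvalP // !big1 ?addn0 // => [i ii|i ii].
    by rewrite big1 // => j _; apply: H; apply: contraNneq ii => -[->].
  by apply: H; apply: contraNneq ii => -[->].
exists (A `|` F)%fset; split => //.
  by rewrite cardfsU disjoint_fsetI0 // cardfs0 subn0 cardF.
split.
- by rewrite !muln_gt0 n0 m0 d_gt0.
- move=> j k s; rewrite -(block_coordK j) -(block_coordK k) block_arrayE.
  case: eqP => [_ /PA sA|/eqP ij]; first by rewrite inE sA.
  rewrite mxE; case Qjk : (Q _ _) => [t|] //= [<-].
  by rewrite inE FP ?orbT //; apply: QB Qjk.
- move=> k; rewrite -(block_coordK k) [LHS]star_count_block.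
  set y := block_coord k; rewrite (bigD1 y.1) //= eqxx Pst; congr (_ + _).
  rewrite -[d.-1](_ : #|predC1 y.1| = _); last by rewrite cardC1 card_ord.
  rewrite -sum_nat_const; apply: eq_bigr => i ni; rewrite (negPf ni).
  rewrite -(Qst y.2); apply: eq_card => j; rewrite !inE mxE.
  by case: (Q j y.2).
- by move=> s /ct ss; apply: cell_count_gt0; rewrite ss muln_gt0 d_gt0.
move=> j1 k1 j2 k2 s.
rewrite -(block_coordK j1) -(block_coordK k1) -(block_coordK j2) -(block_coordK k2).
move: (block_coord j1) (block_coord k1) (block_coord j2) (block_coord k2).
move=> x1 y1 x2 y2 ne; rewrite !block_arrayE.
have eq_coord p (x y : 'I_d * 'I_p) : x.1 = y.1 -> x.2 = y.2 -> x = y.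
  by case: x y => [a b] [a' b'] /= -> ->.
case: (eqVneq x1.1 y1.1) => [e1 P1|ne1].
  case: (eqVneq x2.1 y2.1) => [e2 P2|ne2]; last first.
    rewrite mxE; case Q2 : (Q _ _) => [t|] //= [e].
    have /fdisjointP /(_ _ (PA _ _ _ _ P1)) /negP [] := FA.
    by rewrite -e; apply: FP ne2 _; apply: QB Q2.
  rewrite -e1 -e2 (eq_sym x2.1); case: eqP => [e12|/eqP ne12].
    rewrite -e12 in P2 *.
    have [[_ _ _ _ C3] _] := P_reg x1.1.
    apply: C3 P1 P2; apply: contraNneq ne => -[e3 e4].
    by rewrite (eq_coord _ x1 x2) // (eq_coord _ y1 y2) // -e1 -e2.
  rewrite !mxE; have P1n : P x1.1 x1.2 y1.2 <> None by rewrite P1.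
  by have [-> ->] := PQ ne12 (etrans P1 (esym P2)) P1n.
rewrite mxE; case Q1 : (Q _ _) => [t1|] //= [e].
case: (eqVneq x2.1 y2.1) => [e2 P2|ne2].
  have /fdisjointP /(_ _ (PA _ _ _ _ P2)) /negP [] := FA.
  by rewrite -e; apply: FP ne1 _; apply: QB Q1.
rewrite mxE; case Q2 : (Q _ _) => [t2|] //= [e'].
have t1Q : occurs t1 Q by exists x1.2, y1.2.
have t2Q : occurs t2 Q by exists x2.2, y2.2.
have [e1 e2 e3] := rho_inj _ _ _ _ _ _ ne1 ne2 t1Q t2Q (etrans e (esym e')).
rewrite -e1 -e2 (negPf ne1) !mxE.
rewrite -e3 in Q2; suff ne12 : (x1.2, y1.2) != (x2.2, y2.2).
  by have [-> ->] := QC3 _ _ _ _ _ ne12 Q1 Q2.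
apply: contraNneq ne => -[e4 e5].
by rewrite (eq_coord _ x1 x2) // (eq_coord _ y1 y2).
Qed.

End Lifting.


(** * Rotating the edges and loops of K_2d by the circle method *)

Definition shift m (a : nat) (k : 'I_m) : 'I_m :=
  Ordinal (ltn_pmod (k + a) (leq_ltn_trans (leq0n k) (ltn_ord k))).

Lemma ord_modDr_inj m a (k l : 'I_m) : k + a = l + a %[mod m] -> k = l.
Proof. by move/eqP; rewrite eqn_modDr !modn_small // => /eqP /val_inj. Qed.

Lemma modDl_inj m k a b : a < m -> b < m -> k + a = k + b %[mod m] -> a = b.
Proof. by move=> am bm /eqP; rewrite eqn_modDl !modn_small // => /eqP. Qed.

Section Rotation.

Variable d : nat.
Hypothesis d_gt0 : 0 < d.

Local Notation class := 'I_(2 * d).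

(* The k-th edge of the r-th perfect matching of K_2d on Z/(2d-1) together with the
   point at infinity 2d-1: {infinity, r} for k = 0 and {r + k, r - k} otherwise. *)
Definition circle_fst (r k : nat) : nat :=
  if k == 0 then 2 * d - 1
  else if r + k < 2 * d - 1 then r + k else r + k - (2 * d - 1).

Definition circle_snd (r k : nat) : nat :=
  if k <= r then r - k else r + (2 * d - 1) - k.

(** Modulo 2d - 1 the residues 0, k and -k for 0 < k < d are pairwise distinct, and infinity is met
    only by the edge with k = 0. *)
Lemma circle_disjoint r k k' : r < 2 * d - 1 -> k < d -> k' < d -> k != k' ->
  [/\ circle_fst r k <> circle_fst r k', circle_fst r k <> circle_snd r k',
      circle_snd r k <> circle_fst r k' & circle_snd r k <> circle_snd r k'].
Proof.
rewrite /circle_fst /circle_snd => *; split;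
  by do ?[case: eqP => ?|case: ltnP => ?|case: leqP => ?]; lia.
Qed.

Lemma circle_neq r k : r < 2 * d - 1 -> k < d -> circle_fst r k <> circle_snd r k.
Proof.
rewrite /circle_fst /circle_snd => *.
by do ?[case: eqP => ?|case: ltnP => ?|case: leqP => ?]; lia.
Qed.

(** An edge determines its matching: the endpoints of a finite edge sum to 2r modulo the odd number
    2d - 1, and the edge through infinity contains r. *)
Lemma circle_inj r k r' k' : r < 2 * d - 1 -> k < d -> r' < 2 * d - 1 -> k' < d ->
  circle_fst r k = circle_fst r' k' /\ circle_snd r k = circle_snd r' k' \/
  circle_fst r k = circle_snd r' k' /\ circle_snd r k = circle_fst r' k' ->
  r = r'.
Proof.
rewrite /circle_fst /circle_snd => ? ? ? ? H.
by move: H; do ?[case: eqP => ?|case: ltnP => ?|case: leqP => ?]; lia.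
Qed.

Lemma circle_fst_lt r k : r < 2 * d - 1 -> k < d -> circle_fst r k < 2 * d.
Proof. by rewrite /circle_fst => ? ?; do 2?[case: ifP => ?]; lia. Qed.

Lemma circle_snd_lt r k : r < 2 * d - 1 -> k < d -> circle_snd r k < 2 * d.
Proof. by rewrite /circle_snd => ? ?; case: ifP => ?; lia. Qed.

(* A code (r, k, o) stands for the k-th edge of the r-th matching with orientation o,
   a code u for the loop at u. *)
Definition circle_code : finType :=
  ('I_(2 * d - 1) * 'I_d * bool + 'I_(2 * d))%type.

Definition circle_edge (t : circle_code) : class * class :=
  match t with
  | inl (r, k, o) =>
      let e := (Ordinal (circle_fst_lt (ltn_ord r) (ltn_ord k)),
                Ordinal (circle_snd_lt (ltn_ord r) (ltn_ord k))) in
      if o then swap_pair e else e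
  | inr u => (u, u)
  end.

Lemma circle_edge_inj : injective circle_edge.
Proof.
case=> [[[r k] o]|u] [[[r' k'] o']|u'] /=.
- move=> e; have {}e :
    circle_fst r k = circle_fst r' k' /\ circle_snd r k = circle_snd r' k' /\ o = o' \/
    circle_fst r k = circle_snd r' k' /\ circle_snd r k = circle_fst r' k' /\ o != o'.
    by case: o o' e => [] [] /= [] *; [left|right|right|left].
  have er : r = r'.
    apply: val_inj.
    by apply: circle_inj (ltn_ord _) (ltn_ord k) (ltn_ord _) (ltn_ord k') _; tauto.
  (* A reversed coincidence with k = k' would make the edge a loop; with k <> k', two edges of one
     matching would meet. *)
  subst r'; case: (eqVneq k k') e => [<-|kk'] e.
    have := circle_neq (ltn_ord r) (ltn_ord k).
    by case: e => [[_ [_ ->]]|[? []]].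
  have [] := circle_disjoint (ltn_ord r) (ltn_ord k) (ltn_ord k') kk'.
  by tauto.
- have := circle_neq (ltn_ord r) (ltn_ord k).
  by case: o => ne /= [/(congr1 val) /= e1 /(congr1 val) /= e2]; case: ne; rewrite e1 e2.
- have := circle_neq (ltn_ord r') (ltn_ord k').
  by case: o' => ne /= [/(congr1 val) /= e1 /(congr1 val) /= e2]; case: ne; rewrite -e1 -e2.
- by case=> ->.
Qed.

Definition code_flip (t : circle_code) : circle_code :=
  match t with inl (r, k, o) => inl (r, k, ~~ o) | inr u => inr u end.

(** Keeping the matching [r] fixed ensures that edges moved onto each other are disjoint; keeping
    the orientation [o] makes the shift commute with [code_flip]. Edges shift modulo d, loops modulo
    2d. *)
Definition code_shift (a : nat) (t : circle_code) : circle_code :=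
  match t with inl (r, k, o) => inl (r, shift a k, o) | inr u => inr (shift a u) end.

Lemma circle_edge_flip t : circle_edge (code_flip t) = swap_pair (circle_edge t).
Proof. by case: t => [[[r k] []]|u]. Qed.

Lemma code_shift_inj a : injective (code_shift a).
Proof.
case=> [[[r k] o]|u] [[[r' k'] o']|u'] //= [].
  by move=> -> /ord_modDr_inj -> ->.
by move=> /ord_modDr_inj ->.
Qed.

Definition disjoint_pairs (T : eqType) (e e' : T * T) : bool :=
  [&& e.1 != e'.1, e.1 != e'.2, e.2 != e'.1 & e.2 != e'.2].

(** Distinct shifts below d differ modulo d and modulo 2d, so the two codes are distinct edges of
    one matching or distinct loops. *)
Lemma code_shift_disjoint (a b : 'I_d) t t' :
  a != b -> code_shift a t = code_shift b t' ->
  disjoint_pairs (circle_edge t) (circle_edge t').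
Proof.
move=> ab.
have ne m (k l : 'I_m) : d <= m -> k + a = l + b %[mod m] -> k != l.
  move=> dm e; apply: contraNneq ab => kl; rewrite kl in e.
  by apply/eqP/val_inj; apply: modDl_inj e; apply: leq_trans (ltn_ord _) dm.
case: t t' => [[[r k] o]|u] [[[r' k'] o']|u'] //= [].
  move=> <- /(ne _ _ _ (leqnn d)) kk' <-.
  have [] := circle_disjoint (ltn_ord r) (ltn_ord k) (ltn_ord k') kk'.
  by case: o => /= *; apply/and4P; split; apply/eqP => -[].
have dd : d <= 2 * d by rewrite leq_pmull.
by move=> /(ne _ _ _ dd) uu'; rewrite /disjoint_pairs /= uu'.
Qed.

(** [F a] is [code_shift a] conjugated by the bijection [circle_edge]. Commutation with [swap_pair]
    lets it act on unordered edges. *)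
Lemma rotation_exists : exists F : 'I_d -> class * class -> class * class,
  [/\ forall a, injective (F a),
      forall a e, F a (swap_pair e) = swap_pair (F a e) &
      forall a b e e', a != b -> F a e = F b e' -> disjoint_pairs e e'].
Proof.
have [dec edgeK decK] : bijective circle_edge.
  apply: inj_card_bij circle_edge_inj _.
  (* Injectivity suffices since 2d(2d - 1) + 2d = (2d)^2. *)
  rewrite card_prod card_sum !card_prod !card_ord card_bool; nia.
exists (fun a e => circle_edge (code_shift a (dec e))); split.
- move=> a; apply: inj_comp circle_edge_inj _.
  exact: inj_comp (@code_shift_inj a) (can_inj decK).
- move=> a e; rewrite -circle_edge_flip; congr circle_edge.
  have -> : dec (swap_pair e) = code_flip (dec e).
    by apply: circle_edge_inj; rewrite circle_edge_flip !decK.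
  by case: (dec e) => [[[? ?] ?]|?].
move=> a b e e' ab /circle_edge_inj /(code_shift_disjoint ab).
by rewrite !decK.
Qed.

End Rotation.

(** * Regularity of [P_star] *)

Lemma card_antidiag n t s : cell_count s (antidiag n t) = (t == s) * n.
Proof.
rewrite cell_count_sum -[n in RHS]card_ord mulnC -sum_nat_const.
apply: eq_bigr => i _; rewrite (bigD1 (rev_ord i)) //= mxE eqxx big1 ?addn0 //.
by move=> j /negPf ji; rewrite mxE ji.
Qed.

Lemma star_count_antidiag n t k : star_count (antidiag n t) k = n.-1.
Proof.
rewrite /star_count -[n in RHS]card_ord -(cardC1 (rev_ord k)).
apply: eq_card => j; rewrite !inE mxE -{1}(rev_ordK k) (inj_eq rev_ord_inj).
by rewrite [_ == j]eq_sym; case: (j == _).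
Qed.

(** Distinct entries of [T] confine each integer to one block, where two antidiagonal cells cross
    off the antidiagonal. *)
Lemma block_antidiag_regular a n (T : 'M[int]_a) :
  0 < a -> 0 < n -> injective (fun x : 'I_a * 'I_a => T x.1 x.2) ->
  regular_pda n (a * n.-1) [fset T x.1 x.2 | x in {: 'I_a * 'I_a}]%fset
    (block_array (fun i j => antidiag n (T i j))).
Proof.
move=> a0 n0 Tinj; set S := [fset _ | _ in _]%fset.
have ct s : s \in S ->
    cell_count s (block_array (fun i j => antidiag n (T i j))) = n.
  case/imfsetP => -[i0 j0] _ ->; rewrite cell_count_block (bigD1 i0) //=.
  rewrite (bigD1 j0) //= card_antidiag eqxx mul1n.
  have H i j : (i, j) != (i0, j0) ->
      cell_count (T i0 j0) (antidiag n (T i j)) = 0.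
    move=> ne; rewrite card_antidiag; case: eqP => // e.
    by rewrite (Tinj (i, j) (i0, j0) e) eqxx in ne.
  rewrite !big1 ?addn0 // => [i ii|i ii].
    by rewrite big1 // => j _; apply: H; apply: contraNneq ii => -[->].
  by apply: H; apply: contraNneq ii => -[->].
split=> //; split.
- by rewrite muln_gt0 a0 n0.
- move=> j k s; rewrite -(block_coordK j) -(block_coordK k) block_arrayE mxE.
  case: eqP => // _ [<-]; apply/imfsetP.
  by exists ((block_coord j).1, (block_coord k).1).
- move=> k; rewrite -(block_coordK k) [LHS]star_count_block -[a in RHS]card_ord.
  by rewrite -sum_nat_const; apply: eq_bigr => i _; rewrite star_count_antidiag.
- by move=> s /ct sn; apply: cell_count_gt0; rewrite sn.
move=> j1 k1 j2 k2 s.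
rewrite -(block_coordK j1) -(block_coordK k1) -(block_coordK j2) -(block_coordK k2).
move: (block_coord j1) (block_coord k1) (block_coord j2) (block_coord k2).
move=> [i1 u1] [l1 v1] [i2 u2] [l2 v2] ne; rewrite !block_arrayE !mxE /=.
case: eqP => // e1 [<-]; case: eqP => // e2 [/esym e].
have [ei el] := Tinj (i1, l1) (i2, l2) e; subst i2 l2 v1 v2.
by rewrite !(inj_eq rev_ord_inj) eq_sym; case: eqP => // eu; rewrite eu eqxx in ne.
Qed.

Lemma regular_pda_cast r n n' Z S (e : n = n') (M : array n n) :
  regular_pda r Z S M -> regular_pda r Z S (castmx (e, e) M).
Proof. by case: _ / e; rewrite castmx_id. Qed.

Lemma all_distinct_inj n : injective (fun x : 'I_n * 'I_n => all_distinct n x.1 x.2).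
Proof.
move=> [i j] [k l]; rewrite !mxE /= => -[e].
have n0 : 0 < n by apply: leq_ltn_trans (ltn_ord i).
have ei : i = k.
  apply/val_inj; have := congr1 (fun x => x %/ n) e.
  by rewrite /= !divnMDl // !divn_small // !addn0.
have ej : j = l by apply/val_inj; move: e; rewrite ei => /addnI.
by rewrite ei ej.
Qed.

Lemma P_star_regular g d (dvd_dg : d %| g) : 0 < g -> 0 < d ->
  exists2 B : {fset int}, #|` B| = (g %/ d) ^ 2 &
    regular_pda (2 * d) (g %/ d * (2 * d).-1) B (P_star dvd_dg).
Proof.
move=> g0 d0; exists [fset all_distinct (g %/ d) x.1 x.2 |
    x in {: 'I_(g %/ d) * 'I_(g %/ d)}]%fset.
  rewrite card_imfset /=; last exact: all_distinct_inj.
  by rewrite -cardE card_prod card_ord.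
apply/regular_pda_cast/block_antidiag_regular.
- by rewrite divn_gt0 // dvdn_leq.
- by rewrite muln_gt0.
- exact: all_distinct_inj.
Qed.

(** * Arrays labelled by the edges of a complete graph *)

Section EdgeArray.

Variable N : nat.
Local Notation vertex := 'I_N.

(** An arbitrary injection into the integers; unordered pairs are encoded as sets of vertices. *)
Definition set_label (s : {set vertex}) : int := Posz (choice.pickle s).

Lemma set_label_inj : injective set_label.
Proof. by move=> s t [] /(pcan_inj choice.pickleK). Qed.

Definition edge_label (e : vertex * vertex) : int := set_label [set e.1; e.2].

Lemma edge_label_swap e : edge_label (swap_pair e) = edge_label e.
Proof. by rewrite /edge_label setUC. Qed.

Lemma edge_label_eq e e' : edge_label e = edge_label e' -> e = e' \/ e = swap_pair e'.
Proof.
case: e e' => [x y] [x' y'] /set_label_inj /setP /= E.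
have := E x; have := E y; have := E x'; have := E y'; rewrite !inE !eqxx ?orbT /=.
move=> /pred2P hy' /pred2P hx' /esym/pred2P hy /esym/pred2P hx; rewrite /swap_pair /=.
by case: hx hy hx' hy' => -> [] -> [] ? [] ?; subst; auto.
Qed.

Definition edge_labels : {fset int} :=
  [fset set_label s | s in [set s : {set vertex} | #|s| == 2]]%fset.

Lemma card_edge_labels : #|` edge_labels| = 'C(N, 2).
Proof.
rewrite card_imfset /=; last exact: set_label_inj.
by rewrite -cardE card_draws card_ord.
Qed.

Lemma edge_labelP e : e.1 != e.2 -> edge_label e \in edge_labels.
Proof.
by move=> ne; apply/imfsetP; exists [set e.1; e.2]; rewrite //= inE cards2 ne.
Qed.

Variables (c : vertex -> vertex) (pi : vertex * vertex -> vertex * vertex).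
Hypothesis c_inj : injective c.
Hypothesis pi_inj : injective pi.
Hypothesis pi_swap : forall e, pi (swap_pair e) = swap_pair (pi e).

Definition edge_array : array N N :=
  \matrix_(i, j) if i == c j then None else Some (edge_label (pi (i, c j))).

(** Loops are the fixed points of [swap_pair], with which the injection [pi] commutes. *)
Lemma pi_diag e : ((pi e).1 == (pi e).2) = (e.1 == e.2).
Proof.
have D (x : vertex * vertex) : (x.1 == x.2) = (swap_pair x == x).
  by case: x => u v; rewrite xpair_eqE /= eq_sym [v == _]eq_sym andbb.
by rewrite !D -pi_swap (inj_eq pi_inj).
Qed.

Lemma edge_label_pi e e' : edge_label (pi e) = edge_label (pi e') ->
  e = e' \/ e = swap_pair e'.
Proof.
by case/edge_label_eq => [/pi_inj|]; [left|rewrite -pi_swap => /pi_inj; right].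
Qed.

(** The label of an edge comes from one preimage [e] under [pi] and its reversal, hence from two
    cells. These cross at cells whose row is the [c]-image of the column, which are the stars. *)
Lemma edge_array_regular : 0 < N -> regular_pda 2 1 edge_labels edge_array.
Proof.
move=> N0; have [c' cK c'K] := injF_bij c_inj.
have [pi' piK pi'K] := injF_bij pi_inj.
have ct s : s \in edge_labels -> cell_count s edge_array = 2.
  case/imfsetP => t /=; rewrite inE => /cards2P [x [y [xy ->]]] ->.
  set e := pi' (x, y); have pe : pi e = (x, y) by rewrite /e pi'K.
  have ne : e.1 != e.2 by rewrite -pi_diag pe.
  (* The two cells differ because [e] is not a loop. *)
  transitivity #|[set (e.1, c' e.2); (e.2, c' e.1)]|; last first.
    by rewrite cards2 xpair_eqE (negPf ne).
  apply: eq_card => -[i j]; rewrite !inE mxE /=.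
  have -> : set_label [set x; y] = edge_label (pi e) by rewrite pe.
  apply/eqP/orP => [|[]/eqP[-> ->]].
  - case: eqP => // _ /Some_inj /edge_label_pi [E|[-> E]].
      by left; rewrite -E /= cK.
    by right; rewrite -E cK.
  - by rewrite c'K (negPf ne) -surjective_pairing.
  by rewrite c'K eq_sym (negPf ne) -/(swap_pair e) pi_swap edge_label_swap.
split=> //; split=> //.
- move=> j k s; rewrite mxE; case: eqP => // /eqP jk [<-].
  by apply: edge_labelP; rewrite pi_diag.
- move=> k; rewrite -(cards1 (c k)); apply: eq_card => j; rewrite !inE mxE.
  by case: (j == c k).
- by move=> s /ct ss; apply: cell_count_gt0; rewrite ss.
move=> j1 k1 j2 k2 s ne; rewrite !mxE; case: eqP => // _ [<-].
case: eqP => // _ /Some_inj /esym /edge_label_pi [[ej /c_inj ek]|[ej ek]].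
  by rewrite ej ek eqxx in ne.
by rewrite ej ek !eqxx.
Qed.

End EdgeArray.

(** * Vertex classes and compatibility with [P_star] *)

Section Construction.

Variables g d : nat.
Hypotheses (g_gt0 : 0 < g) (d_gt0 : 0 < d) (dvd_dg : d %| g).

Local Notation vertex := 'I_(2 * g).
Local Notation class := 'I_(2 * d).

Definition vertex_of (x : 'I_(g %/ d) * class) : vertex :=
  cast_ord (P_star_size dvd_dg) (block_index x).

Definition coord (i : vertex) : 'I_(g %/ d) * class :=
  block_coord (cast_ord (esym (P_star_size dvd_dg)) i).

Arguments coord : simpl never.

Lemma coordK : cancel coord vertex_of.
Proof. by move=> i; rewrite /vertex_of block_coordK cast_ordKV. Qed.

Lemma vertex_ofK : cancel vertex_of coord.
Proof. by move=> x; rewrite /coord cast_ordK block_indexK. Qed.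

(** This is the bijection from columns to rows. Reversal inside blocks turns the antidiagonal
    condition of [P_star] into equality of classes. *)
Definition flip_class (j : vertex) : vertex :=
  vertex_of ((coord j).1, rev_ord (coord j).2).

Lemma flip_class_inj : injective flip_class.
Proof.
move=> i j /(can_inj vertex_ofK) /pair_equal_spec [e1 /rev_ord_inj e2].
by apply: (can_inj coordK); rewrite [LHS]surjective_pairing e1 e2 -surjective_pairing.
Qed.

Lemma P_star_None i j :
  (coord i).2 != (coord (flip_class j)).2 -> P_star dvd_dg i j = None.
Proof.
rewrite vertex_ofK /= => ij; rewrite castmxE -(block_coordK (cast_ord _ i)).
rewrite -(block_coordK (cast_ord _ j)) block_arrayE mxE -/(coord i) -/(coord j).
by rewrite -(inj_eq rev_ord_inj) rev_ordK eq_sym in ij; rewrite (negPf ij).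
Qed.

(** Each endpoint keeps its block while [F] moves the classes. Distinct vertices may share a class,
    which is why loops of K_2d are rotated too. *)
Definition lift_rotation (F : class * class -> class * class) (e : vertex * vertex) :
    vertex * vertex :=
  let e' := F ((coord e.1).2, (coord e.2).2) in
  (vertex_of ((coord e.1).1, e'.1), vertex_of ((coord e.2).1, e'.2)).

Lemma lift_rotation_inj F : injective F -> injective (lift_rotation F).
Proof.
move=> Finj [x y] [x' y']; rewrite /lift_rotation /=.
move=> /pair_equal_spec [/(can_inj vertex_ofK) /pair_equal_spec [e1 e2]].
move=> /(can_inj vertex_ofK) /pair_equal_spec [e3 e4].
have /Finj/pair_equal_spec [e5 e6] :
    F ((coord x).2, (coord y).2) = F ((coord x').2, (coord y').2).
  by rewrite [LHS]surjective_pairing e2 e4 -surjective_pairing.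
by congr pair; apply: (can_inj coordK);
  rewrite [LHS]surjective_pairing [RHS]surjective_pairing; congr pair.
Qed.

Lemma lift_rotation_swap F : (forall e, F (swap_pair e) = swap_pair (F e)) ->
  forall e, lift_rotation F (swap_pair e) = swap_pair (lift_rotation F e).
Proof.
by move=> Fs [x y]; rewrite /lift_rotation /= -/(swap_pair ((coord x).2, _)) Fs.
Qed.

Lemma lift_rotation_classes F F' e e' : lift_rotation F e = lift_rotation F' e' ->
  F ((coord e.1).2, (coord e.2).2) = F' ((coord e'.1).2, (coord e'.2).2).
Proof.
move=> /pair_equal_spec [/(can_inj vertex_ofK) /pair_equal_spec [_ e1]].
move=> /(can_inj vertex_ofK) /pair_equal_spec [_ e2].
by rewrite [LHS]surjective_pairing e1 e2 -surjective_pairing.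
Qed.

Definition rotated_array (F : class * class -> class * class) : array (2 * g) (2 * g) :=
  edge_array flip_class (lift_rotation F).

Variable F : 'I_d -> class * class -> class * class.
Hypothesis F_swap : forall a e, F a (swap_pair e) = swap_pair (F a e).
Hypothesis F_disjoint :
  forall a b e e', a != b -> F a e = F b e' -> disjoint_pairs e e'.

Lemma rotated_array_disjoint a b i1 j1 i2 j2 : a != b ->
  rotated_array (F a) i1 j1 = rotated_array (F b) i2 j2 ->
  rotated_array (F a) i1 j1 <> None ->
  disjoint_pairs ((coord i1).2, (coord (flip_class j1)).2)
    ((coord i2).2, (coord (flip_class j2)).2).
Proof.
move=> ab; rewrite !mxE; case: eqP => // _; case: eqP => // _.
move=> /Some_inj /edge_label_eq [] E _.
  exact: F_disjoint ab (lift_rotation_classes E).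
(* If the lifted edges agree up to reversal, [F_swap] moves the reversal to the preimage, and
   disjointness ignores orientation. *)
move: E; rewrite -lift_rotation_swap // => /lift_rotation_classes /(F_disjoint ab).
by case/and4P => *; apply/and4P; split.
Qed.

Lemma rotated_array_compatible :
  compatible_family (P_star dvd_dg) (fun a => rotated_array (F a)).
Proof.
move=> a b ab i1 j1 i2 j2 E /(rotated_array_disjoint ab E) /and4P [_ n1 n2 _].
by split; apply: P_star_None => //; rewrite eq_sym.
Qed.

(** A set of d arrays requires them to be distinct. If two coincided, a cell holding an integer
    would have classes disjoint from themselves. *)
Lemma rotated_array_inj : injective (fun a => rotated_array (F a)).
Proof.
move=> a b E; apply/eqP/negPn/negP => ab.
have g2 : 1 < 2 * g by rewrite mul2n -addnn; case: g g_gt0 => // n _; rewrite addnS.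
(* Vertices 0 and 1 differ, so the cell in row [i] and column [c i'] is not a star. *)
pose i : vertex := Ordinal (ltnW g2); pose i' : vertex := Ordinal g2.
have [c cK Kc] := injF_bij flip_class_inj.
have ne : rotated_array (F a) i (c i') <> None by rewrite mxE Kc.
have := rotated_array_disjoint ab (congr1 (fun M : array _ _ => M i (c i')) E) ne.
by rewrite /disjoint_pairs eqxx.
Qed.

End Construction.

(** * Assembly and the final parameters *)

Theorem lemma17 (g d : nat) (g_gt0 : 0 < g) (d_gt0 : 0 < d) (dvd_dg : d %| g) :
  exists P : 'I_d -> array (2 * g) (2 * g),
    [/\ injective P,
        forall i, pda_card 1 (g * (2 * g - 1)) (P i),
        compatible_family (P_star dvd_dg) P &
        forall L, is_lifting P (P_star dvd_dg) L ->
          regular_pda_card (2 * d) (2 * g * d + g %/ d + 1 - 3 * g)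
            (g * (3 * g - g %/ d - 1)) L].
Proof.
have [F [F_inj F_swap F_disj]] := rotation_exists d_gt0.
have g2 : 0 < 2 * g by rewrite muln_gt0.
have P_reg a : regular_pda 2 1 (edge_labels (2 * g)) (rotated_array dvd_dg (F a)).
  apply: edge_array_regular => //; first exact: flip_class_inj.
    exact: lift_rotation_inj.
  exact: lift_rotation_swap.
have card_labels : #|` edge_labels (2 * g)| = g * (2 * g - 1).
  by rewrite card_edge_labels bin2 -mulnA mul2n doubleK subn1.
have comp := rotated_array_compatible (dvd_dg := dvd_dg) F_swap F_disj.
exists (fun a => rotated_array dvd_dg (F a)); split => //.
- exact: rotated_array_inj.
- by move=> a; exists (edge_labels (2 * g)); last by case: (P_reg a).
move=> L LP; have [B cardB Q_reg] := P_star_regular dvd_dg g_gt0 d_gt0.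
rewrite (mulnC 2 d) in Q_reg.
have := lifting_regular d_gt0 (ltn0Sn 1) P_reg Q_reg comp LP.
rewrite cardB card_labels (mulnC d 2).
have m0 : 0 < g %/ d by rewrite divn_gt0 // dvdn_leq.
have gE := divnK dvd_dg; set m := g %/ d in m0 gE *.
(* The left sides are the star and integer counts of the lifting. Subtracting [3 * g] last avoids
   truncation, as 2gd < 3g when d = 1. *)
suff [-> ->] :
  1 + d.-1 * (m * (2 * d).-1) = 2 * g * d + m + 1 - 3 * g /\
  g * (2 * g - 1) + d * d.-1 * m ^ 2 = g * (3 * g - m - 1) by [].
rewrite -gE; case: (d) d_gt0 => // k _; set h := m * k.+1.
(* With d = k + 1 and g = h, [e1] settles the stars and [e2] the integers; [h0] keeps the natural
   subtraction of [h] exact. *)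
have e1 : 2 * h * k.+1 + m = k * (m * (2 * k).+1) + 3 * h by rewrite /h; lia.
have e2 : k.+1 * k * m ^ 2 + h * m = h * h by rewrite /h; lia.
have h0 : h <= h * h by rewrite leq_pmulr // muln_gt0 m0.
rewrite mulnS /= !mulnBr muln1 !(mulnCA h).
by split; lia.
Qed.
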